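(* Let $\Sigma$ be a totally ordered alphabet with $|\Sigma| > n$, and let $\pi$ be a type 1 order with parameter $m$. Any $R$-pass randomized streaming algorithm that, for every $x \in \Sigma^n$ given in order $\pi$, computes $\mathrm{LIS}(x)$ correctly with probability at least $2/3$ needs $\Omega(m/R)$ space.
   Context: $\mathrm{LIS}(x)$ is the length of a longest strictly increasing subsequence of $x = x_1\cdots x_n$. A streaming order is a permutation $\pi$ of $[n]$; in each pass the algorithm sees $x_{\pi_1}, \dots, x_{\pi_n}$ in that order. A permutation $\pi$ is a type 1 order with parameter $m$ if there are index sets $I = \{i_1,\dots,i_m\}$ and $J = \{j_1,\dots,j_m\}$ with $|I|=|J|=m$, $\max(I) < \min(J)$, and $1 \le \pi_{i_1} < \pi_{j_1} < \pi_{i_2} < \pi_{j_2} < \cdots < \pi_{i_m} < \pi_{j_m} < n$. Space is measured in bits. *)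

(* Defs.v *)
From HB Require Import structures.
From mathcomp Require Import all_boot all_order all_algebra all_fingroup.
From mathcomp Require Import all_classical all_reals all_analysis.

Set Implicit Arguments.
Unset Strict Implicit.
Unset Printing Implicit Defensive.

Import Order.TTheory GRing.Theory Num.Theory.

Section LIS.
Context {disp : Order.disp_t} {Sigma : orderType disp} {n : nat}.

(* The subsequences of [x] are the sequences [mask b x] (cf. [subseqP]). *)
Definition LIS (x : n.-tuple Sigma) : nat :=
  \max_(b : n.-tuple bool | sorted <%O (mask b x)) size (mask b x).

End LIS.

Section StreamingOrder.
Variables (n : nat) (pi : 'S_n) (m : nat).

(* A streaming order maps a time [t] to the position [pi t] read at time [t];
   times and positions are numbered from 0, so the 1-based bound
   pi_{j_m} < n reads [(pi (j k)).+1 < n] for the last [k]. *)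
Definition type1_order : Prop :=
  exists (I J : {set 'I_n}) (i j : 'I_m -> 'I_n),
    [/\ [/\ I = [set i k | k : 'I_m], J = [set j k | k : 'I_m],
            #|I| = m & #|J| = m],
        {in I & J, forall s t : 'I_n, (s < t)%N},
        forall k : 'I_m, (pi (i k) < pi (j k))%N,
        forall k l : 'I_m, k.+1 = l -> (pi (j k) < pi (i l))%N
      & forall k : 'I_m, k.+1 = m -> ((pi (j k)).+1 < n)%N].

End StreamingOrder.

Section StreamingAlgorithm.
Local Open Scope classical_set_scope.
Variables (Sigma : Type) (n R S : nat).

(* Deterministic [R]-pass algorithm with [S] bits of memory.  The model is
   non-uniform: the transition may depend on the pass and on the time within
   the pass without these being charged to the memory. *)
Record streaming_alg := StreamingAlg {
  sa_init : S.-tuple bool;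
  sa_step : 'I_R -> 'I_n -> S.-tuple bool -> Sigma -> S.-tuple bool;
  sa_output : S.-tuple bool -> nat
}.

Definition run_pass (pi : 'S_n) (A : streaming_alg) (x : n.-tuple Sigma)
    (q : S.-tuple bool) (r : 'I_R) : S.-tuple bool :=
  foldl (fun q t => sa_step A r t q (tnth x (pi t))) q (enum 'I_n).

Definition run (pi : 'S_n) (A : streaming_alg) (x : n.-tuple Sigma) : nat :=
  sa_output A (foldl (run_pass pi A x) (sa_init A) (enum 'I_R)).

(* A randomized algorithm is a family of deterministic ones indexed by a seed
   [w] drawn from a probability space, whose output on every input is a random
   variable.  The seed is not charged to the memory and stays available in all
   passes, so fresh coin tosses at each step are a special case. *)
Definition randomized_alg (pi : 'S_n) d (T : measurableType d)
    (A : T -> streaming_alg) : Prop :=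
  forall x : n.-tuple Sigma, measurable_fun setT (fun w => run pi (A w) x).

Definition computes_with_prob (pi : 'S_n) (f : n.-tuple Sigma -> nat)
    (K : realType) (p : K) d (T : measurableType d) (P : probability T K)
    (A : T -> streaming_alg) : Prop :=
  forall x : n.-tuple Sigma, (p%:E <= P [set w | run pi (A w) x = f x])%E.

End StreamingAlgorithm.

(* Main.v *)
Require Import Defs.
From HB Require Import structures.
From mathcomp Require Import all_boot all_order all_algebra all_fingroup.
From mathcomp Require Import all_classical all_reals all_analysis.
From mathcomp Require Import measurable_realfun.
From mathcomp Require Import ring lra zify.

Set Implicit Arguments.
Unset Strict Implicit.
Unset Printing Implicit Defensive.

Import Order.TTheory GRing.Theory Num.Theory.

(* Reduction from the inner product mod 2.  Alice owns the positions read at the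
   times in I, Bob those read at the times in J; they interleave, so bit vectors
   a and b can be encoded in a word whose LIS is 1 + m + |a AND b|.  As I
   precedes J, a pass is one message from Alice to Bob and one back, so a
   deterministic R-pass algorithm with S bits cuts the inputs into 2^(2RS)
   combinatorial rectangles, on each of which its answer is constant.  The
   parity of |a AND b| has discrepancy at most 2^(3m/2) on every rectangle
   (Lindsey), whereas by averaging over the seed some deterministic algorithm is
   right on 2/3 of the 4^m inputs; hence 4^m / 3 <= 2^(2RS) 2^(3m/2). *)

(** * Increasing subsequences as sets of positions *)

(** The mask lists the selected entries by increasing position, and sortedness for the transitive
    [<%O] is a condition on all pairs. *)
Lemma sorted_mask_tnth (disp : Order.disp_t) (T : orderType disp) (n : nat)
    (x : n.-tuple T) (b : n.-tuple bool) :
  sorted <%O (mask b x) <->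
  {in [set s | tnth b s] &, forall s t : 'I_n, s < t -> (tnth x s < tnth x t)%O}.
Proof.
have -> : mask b x = [seq tnth x s | s <- enum 'I_n & tnth b s].
  by rewrite filter_mask map_mask !map_tnth_enum.
rewrite lt_sorted_pairwise pairwise_map.
have lt_enum : pairwise (relpre (@nat_of_ord n) ltn) [seq s <- enum 'I_n | tnth b s].
  rewrite -pairwise_map -sorted_pairwise; last exact: ltn_trans.
  apply: (subseq_sorted ltn_trans (map_subseq (@nat_of_ord n) (filter_subseq _ _))).
  by rewrite val_enum_ord iota_ltn_sorted.
split=> [xb s t|xb].
  rewrite !inE => bs bt st.
  have /(pairwiseP s) xb' := xb.
  pose e := [seq s <- enum 'I_n | tnth b s].
  have mem_e u : u \in e = tnth b u by rewrite mem_filter mem_enum andbT.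
  have [es et] : s \in e /\ t \in e by rewrite !mem_e.
  have /(_ (index s e) (index t e)) := xb'.
  rewrite !inE /= !index_mem !nth_index // => -> //.
  rewrite ltnNge; apply/negP => ts.
  have := lt_enum => /(pairwiseP s) /(_ (index t e) (index s e)).
  rewrite !inE /= !index_mem !nth_index // => /(_ et es).
  move: ts; rewrite leq_eqVlt => /orP[/eqP ts _|lt_ts /(_ lt_ts)]; last lia.
  have := nth_index s es; rewrite -ts nth_index // => ets.
  by rewrite ets ltnn in st.
apply: (@sub_in_pairwise _ (fun s => tnth b s) _ _ _ _ _ lt_enum) => /=; last first.
  exact: filter_all.
by move=> s t bs bt; apply: xb; rewrite inE.
Qed.

Lemma size_mask_tnth (T : Type) (n : nat) (x : n.-tuple T) (b : n.-tuple bool) :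
  size (mask b x) = #|[set s | tnth b s]|.
Proof.
rewrite size_mask ?size_tuple // -[in LHS](map_tnth_enum b) count_map cardE.
rewrite size_filter -[Finite.enum _]enumT; by apply: eq_count => s; rewrite /= inE.
Qed.

(** Trades masks for sets of positions, on which both bounds for the hard words are proved. *)
Lemma LIS_eq (disp : Order.disp_t) (T : orderType disp) (n l : nat) (x : n.-tuple T) :
  (forall B : {set 'I_n},
     {in B &, forall s t : 'I_n, s < t -> (tnth x s < tnth x t)%O} -> #|B| <= l) ->
  (exists2 B : {set 'I_n},
     {in B &, forall s t : 'I_n, s < t -> (tnth x s < tnth x t)%O} & #|B| = l) ->
  LIS x = l.
Proof.
move=> le_l [B incB cardB]; apply/eqP; rewrite eqn_leq /LIS; apply/andP; split.
  apply/bigmax_leqP => b /sorted_mask_tnth incb.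
  by rewrite size_mask_tnth; exact: le_l.
pose b := [tuple s \in B | s < n].
have bB : [set s | tnth b s] = B by apply/finset.setP => s; rewrite inE tnth_mktuple.
rewrite -cardB -[in leqLHS]bB -(size_mask_tnth x).
by apply: leq_bigmax_cond; apply/sorted_mask_tnth; rewrite bB.
Qed.

(** * Words encoding two bit vectors, and their longest increasing subsequences *)

Section HardWord.
Variables (n m : nat) (p q : 'I_m -> 'I_n) (a b : 'I_m -> bool).

(* Symbols are represented by their ranks.  The two entries of the [k]-th pair
   increase exactly when [a k && b k]; all remaining positions carry the largest
   symbol, which the last position makes available exactly once. *)
Definition hard_key (t : 'I_n) : nat :=
  if [pick k | p k == t] is Some k then k.*2 + ~~ a k
  else if [pick k | q k == t] is Some k then k.*2 + b k
  else m.*2.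

Hypothesis pq : forall k, p k < q k.
Hypothesis qp : forall k l : 'I_m, k.+1 = l -> q k < p l.
Hypothesis q_last : forall k : 'I_m, k.+1 = m -> (q k).+1 < n.

Lemma interleave (k l : 'I_m) : k < l -> q k < p l.
Proof.
case: l => l lm /= ; elim: l lm => // l IH lm; rewrite ltnS leq_eqVlt.
case/orP => [/eqP kl|kl]; first by apply: qp; rewrite /= kl.
have lm' : l < m by lia.
apply: ltn_trans (IH lm' kl) _; apply: ltn_trans (pq _) _; exact: qp.
Qed.

(** Each pair takes two further positions, and the upper bound passes from the last pair to all
    earlier ones. For the last pair this gives [2m < n]: there are symbols enough for the ranks
    [0..2m], and the last position lies beyond every pair. *)
Lemma interleave_bounds (k : 'I_m) : (k.*2.+2 <= (q k).+1) && ((q k).+1 < n).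
Proof.
case: k => k km; apply/andP; split.
  elim: k km => [|k IH] km.
    by have := pq (Ordinal km); rewrite /=; lia.
  have km' : k < m by lia.
  have := IH km'; have := @qp (Ordinal km') (Ordinal km) erefl.
  have := pq (Ordinal km); rewrite /=; lia.
have m'm : m.-1 < m by lia.
have ql : (q (Ordinal m'm)).+1 < n by apply: q_last => /=; lia.
have [km1|km1] := eqVneq k m.-1.
  by rewrite (_ : Ordinal km = Ordinal m'm) //; apply: val_inj.
have : q (Ordinal km) < p (Ordinal m'm) by apply: interleave => /=; lia.
have := pq (Ordinal m'm); lia.
Qed.

Lemma interleaved_inj_l : injective p.
Proof.
move=> k l pkl; apply: val_inj; have [kl|kl|//] := ltngtP (nat_of_ord k) (nat_of_ord l).
  by have := interleave kl; have := pq k; rewrite pkl; lia.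
by have := interleave kl; have := pq l; rewrite pkl; lia.
Qed.

Lemma interleaved_inj_r : injective q.
Proof.
move=> k l qkl; apply: val_inj; have [kl|kl|//] := ltngtP (nat_of_ord k) (nat_of_ord l).
  by have := interleave kl; have := pq l; rewrite qkl; lia.
by have := interleave kl; have := pq k; rewrite qkl; lia.
Qed.

Lemma interleaved_neq (k l : 'I_m) : p k != q l.
Proof.
apply/eqP => pkql; have := pq k; have := pq l.
have [kl|kl|kl] := ltngtP (nat_of_ord k) (nat_of_ord l).
- by have := interleave kl; rewrite pkql; lia.
- by have := interleave kl; rewrite pkql; lia.
- by rewrite -(ord_inj kl) in pkql *; rewrite pkql ltnn.
Qed.

Lemma hard_key_p (k : 'I_m) : hard_key (p k) = k.*2 + ~~ a k.
Proof.
rewrite /hard_key; case: pickP => [l /eqP /interleaved_inj_l -> //|/(_ k)].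
by rewrite eqxx.
Qed.

Lemma hard_key_q (k : 'I_m) : hard_key (q k) = k.*2 + b k.
Proof.
rewrite /hard_key; case: pickP => [l|_]; first by rewrite (negPf (interleaved_neq _ _)).
by case: pickP => [l /eqP /interleaved_inj_r -> //|/(_ k)]; rewrite eqxx.
Qed.

Lemma hard_key_other (t : 'I_n) :
  (forall k, p k != t) -> (forall k, q k != t) -> hard_key t = m.*2.
Proof.
move=> pt qt; rewrite /hard_key; case: pickP => [k|_]; first by rewrite (negPf (pt k)).
by case: pickP => [k|//]; rewrite (negPf (qt k)).
Qed.

Variant position_spec (t : 'I_n) : Prop :=
| PosP k of t = p k
| PosQ k of t = q k
| PosOther of (forall k, p k != t) & (forall k, q k != t).

Lemma positionP (t : 'I_n) : position_spec t.
Proof.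
have [/existsP[k /eqP <-]|/existsPn pt] := boolP [exists k, p k == t].
  exact: PosP.
have [/existsP[k /eqP <-]|/existsPn qt] := boolP [exists k, q k == t].
  exact: PosQ.
exact: PosOther.
Qed.

Lemma hard_key_le (t : 'I_n) : hard_key t <= m.*2.
Proof.
case: (positionP t) => [k ->|k ->|pt qt].
- by rewrite hard_key_p; have := ltn_ord k; case: (a k) => /=; lia.
- by rewrite hard_key_q; have := ltn_ord k; case: (b k) => /=; lia.
- by rewrite hard_key_other.
Qed.

(** Positions outside the pairs share the rank [2m], so at most one of them is chosen. A pair
    contributes two positions only if its entries increase, and at most one otherwise. *)
Lemma increasing_card_le (B : {set 'I_n}) :
  {in B &, forall s t : 'I_n, s < t -> hard_key s < hard_key t} ->
  #|B| <= 1 + m + \sum_(k < m) (a k && b k).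
Proof.
move=> incB.
pose O := [set t in B | [forall k, (p k != t) && (q k != t)]].
have subB : B \subset O :|: \bigcup_k (B :&: [set p k; q k]).
  apply/fintype.subsetP => t tB; rewrite inE; case: (positionP t) => [k tk|k tk|pt qt].
  - by apply/orP; right; apply/bigcupP; exists k; rewrite // !inE tB tk eqxx.
  - by apply/orP; right; apply/bigcupP; exists k; rewrite // !inE tB tk eqxx orbT.
  - by rewrite inE tB; apply/orP; left; apply/forallP => k; rewrite pt qt.
apply: leq_trans (subset_leq_card subB) _.
apply: leq_trans (leq_card_setU _ _) _; rewrite -addnA; apply: leq_add.
  have keyO t : t \in O -> hard_key t = m.*2.
    rewrite inE => /andP[_ /forallP Ot].
    by apply: hard_key_other => k; case/andP: (Ot k).
  apply/card_le1_eqP => s t sO tO; apply: val_inj => /=.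
  have sB : s \in B by move: sO; rewrite inE => /andP[].
  have tB : t \in B by move: tO; rewrite inE => /andP[].
  have [st|st|//] := ltngtP (nat_of_ord s) (nat_of_ord t).
    by have := incB _ _ sB tB st; rewrite !keyO // ltnn.
  by have := incB _ _ tB sB st; rewrite !keyO // ltnn.
have -> : m + \sum_(k < m) (a k && b k) = \sum_(k < m) (1 + (a k && b k)).
  by rewrite big_split /= sum1_card card_ord.
elim/big_rec2: _ => [|k y X _ Xy]; first by rewrite cards0.
apply: leq_trans (leq_card_setU _ _) _; apply: leq_add Xy.
(* If both positions are chosen, then [~~ a k < b k], which forces [a k && b k]. *)
have [/andP[pB qB]|] := boolP ((p k \in B) && (q k \in B)).
  have := incB _ _ pB qB (pq k); rewrite hard_key_p hard_key_q.
  have : #|B :&: [set p k; q k]| <= 2.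
    by apply: leq_trans (subset_leq_card (subsetIr _ _)) _; rewrite cards2; case: eqP.
  by case: (a k) (b k) => [] []; lia.
move=> pqB; apply: (@leq_trans 1); last exact: leq_addr.
apply/card_le1_eqP => s t; rewrite !inE.
by case/andP=> sB /orP[] /eqP ss; case/andP=> tB /orP[] /eqP tt; subst s t;
  rewrite // ?sB ?tB in pqB.
Qed.

Lemma increasing_card_ge :
  0 < m -> exists2 B : {set 'I_n},
    {in B &, forall s t : 'I_n, s < t -> hard_key s < hard_key t} &
    #|B| = 1 + m + \sum_(k < m) (a k && b k).
Proof.
move=> m0; have n0 : n.-1 < n by have := interleave_bounds (Ordinal m0); lia.
pose z := Ordinal n0.
have zp k : p k < z by have := pq k; have := interleave_bounds k; rewrite /=; lia.
have zq k : q k < z by have := interleave_bounds k; rewrite /=; lia.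
have key_z : hard_key z = m.*2.
  by apply: hard_key_other => k; apply/eqP => kz; have := zp k; have := zq k;
    rewrite kz ltnn.
pose A := [set k | a k && b k].
(* The witness takes every [q k], adds [p k] where the pair increases, and ends with the last
   position [z], of rank [2m]. *)
exists (z |: ((q @: 'I_m) :|: (p @: A))).
  move=> s t; rewrite !inE => sB tB.
  case/or3P: sB => [/eqP ->|/imsetP[k _ ->]|/imsetP[k]].
  - by have := ltn_ord t; rewrite /=; lia.
  - case/or3P: tB => [/eqP ->|/imsetP[l _ ->]|/imsetP[l]].
    + by rewrite key_z hard_key_q; have := ltn_ord k; case: (b k); lia.
    + rewrite !hard_key_q; have [kl|kl|kl] := ltngtP (nat_of_ord k) (nat_of_ord l).
      * by case: (b k) (b l) => [] []; lia.
      * by have := interleave kl; have := pq k; lia.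
      * by rewrite (ord_inj kl) ltnn.
    + rewrite inE => /andP[al bl] ->; rewrite hard_key_q hard_key_p al.
      have [kl|kl|kl] := ltngtP (nat_of_ord k) (nat_of_ord l).
      * by case: (b k); lia.
      * by have := interleave kl; have := pq k; have := pq l; lia.
      * by have := pq l; rewrite (ord_inj kl); lia.
  - rewrite inE => /andP[ak bk] ->; rewrite hard_key_p ak.
    case/or3P: tB => [/eqP ->|/imsetP[l _ ->]|/imsetP[l]].
    + by rewrite key_z; have := ltn_ord k; lia.
    + rewrite !hard_key_q; have [kl|kl|kl] := ltngtP (nat_of_ord k) (nat_of_ord l).
      * by case: (b l); lia.
      * by have := interleave kl; have := pq k; lia.
      * by rewrite -(ord_inj kl) bk; lia.
    + rewrite inE => /andP[al bl] ->; rewrite hard_key_p al.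
      have [kl|kl|kl] := ltngtP (nat_of_ord k) (nat_of_ord l).
      * lia.
      * by have := interleave kl; have := pq k; have := pq l; lia.
      * by rewrite (ord_inj kl) ltnn.
have -> : \sum_(k < m) (a k && b k) = #|A|.
  by rewrite -sum1dep_card [RHS]big_mkcond; apply: eq_bigr => k _; case: andP.
rewrite cardsU1 cardsU (_ : _ :&: _ = finset.set0); last first.
  apply/finset.setP => t; rewrite !inE; apply/negP => /andP[/imsetP[k _ ->] /imsetP[l _]].
  by move/esym/eqP; rewrite (negPf (interleaved_neq _ _)).
rewrite cards0 subn0 (card_imset _ interleaved_inj_r).
rewrite (card_imset _ interleaved_inj_l) card_ord addnA.
suff -> : z \notin (q @: 'I_m) :|: (p @: A) by [].
apply/negP; rewrite inE.
by case/orP=> /imsetP[k _ zk]; [have := zq k | have := zp k]; rewrite -zk ltnn.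
Qed.

End HardWord.

(** This lets Alice feed her part of the word to the algorithm without Bob's vector; the next lemma
    serves Bob. *)
Lemma hard_key_indep_r (n m : nat) (p q : 'I_m -> 'I_n) (a b b' : 'I_m -> bool)
    (t : 'I_n) :
  (forall k, q k != t) -> hard_key p q a b t = hard_key p q a b' t.
Proof.
move=> qt; rewrite /hard_key; case: pickP => // _.
by case: pickP => // k; rewrite (negPf (qt k)).
Qed.

Lemma hard_key_indep_l (n m : nat) (p q : 'I_m -> 'I_n) (a a' b : 'I_m -> bool)
    (t : 'I_n) :
  (forall k, p k != t) -> hard_key p q a b t = hard_key p q a' b t.
Proof.
by move=> pt; rewrite /hard_key; case: pickP => // k; rewrite (negPf (pt k)).
Qed.

(** * Discrepancy of the inner product mod 2 under two-party protocols *)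

Local Open Scope classical_set_scope.
Local Open Scope ring_scope.

(** Induction on the passes: the state sent by Alice and the state returned by Bob cut a rectangle
    into [#|Q| ^ 2] smaller ones, on each of which the remaining passes start from a fixed state. *)
Lemma two_party_discrepancy (K : realDomainType) (X Y Q : finType) (pass : Type)
    (M : X -> Y -> K) (D : K) (alice : pass -> Q -> X -> Q)
    (bob : pass -> Q -> Y -> Q) (g : Q -> K) :
  (forall q, `|g q| <= 1) ->
  (forall (U : pred X) (V : pred Y), `|\sum_(x | U x) \sum_(y | V y) M x y| <= D) ->
  forall (rs : seq pass) (q : Q) (U : pred X) (V : pred Y),
    `|\sum_(x | U x) \sum_(y | V y)
        M x y * g (foldl (fun q r => bob r (alice r q x) y) q rs)|
      <= D * ((#|Q| ^ 2) ^ size rs)%:R.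
Proof.
move=> g1 MD; elim=> [|r rs IH] q U V /=.
  (* With no pass left, [g q] is constant on the rectangle and factors out. *)
  rewrite expn0 mulr1 -[leRHS]mulr1.
  under eq_bigr do rewrite -mulr_suml.
  by rewrite -mulr_suml normrM ler_pM.
rewrite (partition_big (alice r q) predT) //=.
have -> : \sum_(q1 : Q) \sum_(x | U x && (alice r q x == q1)) \sum_(y | V y)
    M x y * g (foldl (fun q r => bob r (alice r q x) y) (bob r (alice r q x) y) rs)
  = \sum_(q1 : Q) \sum_(q2 : Q) \sum_(x | U x && (alice r q x == q1))
    \sum_(y | V y && (bob r q1 y == q2))
      M x y * g (foldl (fun q r => bob r (alice r q x) y) q2 rs).
  (* Once Alice's state is [q1], Bob's reply depends on [y] alone, so it partitions [V]. *)
  apply: eq_bigr => q1 _; rewrite [RHS]exchange_big; apply: eq_bigr => x.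
  case/andP=> _ /eqP ->; rewrite (partition_big (bob r q1) predT) //=.
  by apply: eq_bigr => q2 _; apply: eq_bigr => y /andP[_ /eqP ->].
apply: le_trans (ler_norm_sum _ _ _) _.
apply: (@le_trans _ _ (\sum_(q1 : Q) \sum_(q2 : Q) D * ((#|Q| ^ 2) ^ size rs)%:R)).
  apply: ler_sum => q1 _; apply: le_trans (ler_norm_sum _ _ _) _.
  by apply: ler_sum => q2 _; apply: IH.
rewrite !sumr_const -!mulrnA -[leLHS]mulr_natr -mulrA -natrM (expnS (_ ^ 2)).
by rewrite mulnn mulnC.
Qed.

(** Entries of the Sylvester-Hadamard matrix of order [2 ^ m]. *)
Definition ip_sign (K : pzRingType) (m : nat) (a b : {ffun 'I_m -> bool}) : K :=
  (-1) ^+ (\sum_(k < m) (a k && b k)).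

(** The sum over [a] is a product over coordinates, with factor [1 + 1] where [b] and [b'] agree and
    [1 - 1] where they differ. *)
Lemma ip_sign_orthogonal (K : comPzRingType) (m : nat) (b b' : {ffun 'I_m -> bool}) :
  \sum_a ip_sign K a b * ip_sign K a b' = 2 ^+ m *+ (b == b').
Proof.
under eq_bigr => a _ do rewrite /ip_sign !expr_sum -big_split /=.
rewrite -(bigA_distr_bigA (fun k (c : bool) =>
  (-1) ^+ (c && b k) * (-1) ^+ (c && b' k) : K)).
have [<-|/eqP nb] := eqVneq b b'.
  rewrite mulr1n -[m in RHS]card_ord -prodr_const; apply: eq_bigr => k _.
  by rewrite big_bool /=; case: (b k); ring.
have [k bk] : exists k, b k != b' k.
  apply/existsP; rewrite -negb_forall; apply/negP => /forallP bb.
  by apply: nb; apply/ffunP => k; apply/eqP.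
rewrite (bigD1 k) //= big_bool /=.
by case: (b k) (b' k) bk => [] [] //= _; ring.
Qed.

(** Cauchy-Schwarz against the constant vector, read off from the sum of the squares
    [(N * t i - T) ^+ 2]. *)
Lemma sqr_sum_le (K : realFieldType) (I : finType) (t : I -> K) :
  (\sum_i t i) ^+ 2 <= #|I|%:R * \sum_i t i ^+ 2.
Proof.
set T := \sum_i t i; set N : K := #|I|%:R.
have [N0|N0] := posnP #|I|.
  have I0 (i : I) : false by have := card0_eq N0 i; rewrite inE.
  by rewrite /T !big1 ?expr0n ?mulr0 // => i; have := I0 i.
have: 0 <= \sum_i (N * t i - T) ^+ 2 by apply: sumr_ge0 => i _; exact: sqr_ge0.
have -> : \sum_i (N * t i - T) ^+ 2 = N * (N * \sum_i t i ^+ 2 - T ^+ 2).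
  under eq_bigr => i _ do have -> : (N * t i - T) ^+ 2 =
    N ^+ 2 * t i ^+ 2 - 2 * N * T * t i + T ^+ 2 by ring.
  rewrite big_split sumrB sumr_const -!mulr_sumr -/T -[T ^+ 2 *+ _]mulr_natr -/N.
  rewrite /=; ring.
by rewrite pmulr_rge0 ?ltr0n // subr_ge0.
Qed.

(* Lindsey's lemma for the Hadamard matrix [ip_sign]. *)
Lemma ip_rectangle (K : rcfType) (m : nat) (U V : pred {ffun 'I_m -> bool}) :
  `|\sum_(a | U a) \sum_(b | V b) ip_sign K a b| <= Num.sqrt (2 ^+ (3 * m)).
Proof.
rewrite -sqrtr_sqr ler_wsqrtr // big_mkcond.
(* Cauchy-Schwarz over the rows, those outside [U] counting as zero, costs a factor [2 ^+ m]; the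
   rest must be at most [2 ^+ (2 * m)]. *)
apply: le_trans (sqr_sum_le _) _.
have cardB : #|{ffun 'I_m -> bool}|%:R = 2 ^+ m :> K.
  by rewrite card_ffun card_bool card_ord natrX.
rewrite cardB mulSn exprD ler_wpM2l ?exprn_ge0 //.
apply: (@le_trans _ _ (\sum_a (\sum_(b | V b) ip_sign K a b) ^+ 2)).
  by apply: ler_sum => a _; case: ifP; rewrite // expr0n sqr_ge0.
(* After expanding the square, orthogonality leaves only the diagonal: at most [2 ^ m] terms, each
   equal to [2 ^+ m]. *)
under eq_bigr => a _ do rewrite expr2 big_distrlr /=.
rewrite exchange_big /=; under eq_bigr => b _ do rewrite exchange_big /=.
under eq_bigr => b _ do under eq_bigr => b' _ do rewrite ip_sign_orthogonal.
apply: (@le_trans _ _ (\sum_(b : {ffun 'I_m -> bool}) 2 ^+ m)).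
  rewrite big_mkcond; apply: ler_sum => b _; case: ifP => [Vb|_].
    rewrite (bigD1 b) //= eqxx big1 ?addr0 // => b' /andP[_ /negPf].
    by rewrite eq_sym => ->.
  exact: exprn_ge0.
by rewrite sumr_const -[leLHS]mulr_natl cardB -exprD addnn mul2n.
Qed.

(** * Symbols for the ranks, and fixing the seed by averaging *)

Lemma increasing_enumeration (disp : Order.disp_t) (T : orderType disp) (n : nat) :
  ([set: 'I_n.+1] #<= [set: T])%card ->
  exists f : nat -> T,
    {in [pred v | (v < n.+1)%N] &, {mono f : u v / (u < v)%N >-> (u < v)%O}}.
Proof.
move=> /card_leP/unsquash g.
have g_inj : injective (fun i : 'I_n.+1 =>
    val (g (SigSub (mem_set (I : [set: 'I_n.+1] i))))).
  move=> i j /val_inj /(@inj _ _ _ g) /=.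
  by rewrite !inE => /(_ Logic.I Logic.I) [].
set h := (fun i => _) in g_inj.
pose s := sort <=%O [seq h i | i <- enum 'I_n.+1].
have s_lt : sorted <%O s by rewrite sort_lt_sorted map_inj_uniq ?enum_uniq.
have s_size : size s = n.+1 by rewrite size_sort size_map size_enum_ord.
(* Beyond rank [n] the value is the default [h ord0], about which nothing is claimed. *)
by exists (nth (h ord0) s); rewrite -s_size; exact: lt_sorted_ltn_nth.
Qed.

(** The expected number of [x] with [w] in [E x] is the sum of the probabilities of the [E x], hence
    at least [p * #|X|]; some seed reaches the average. *)
Lemma exists_good_seed (K : realType) (d : measure_display) (T : measurableType d)
    (P : probability T K) (X : finType) (E : X -> set T) (p : K) :
  (forall x, measurable (E x)) -> (forall x, (p%:E <= P (E x))%E) ->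
  exists w, p * #|X|%:R <= #|[set x | w \in E x]%SET|%:R.
Proof.
move=> mE pE; apply: contrapT => /forallNP lt_p.
have [w0 _] : [set: T] !=set0.
  apply/set0P/eqP => T0; have := @probability_setT _ _ _ P.
  by rewrite T0 measure0 => /eqP; rewrite eqe eq_sym oner_eq0.
pose N w := #|[set x | w \in E x]%SET|.
(* The count is bounded by [#|X|], so its maximum is attained; the constant [N w1] then dominates
   the integrand, and no strict inequality of integrals is required. *)
have [w1 w1max] : exists w1, forall w, (N w <= N w1)%N.
  have : exists k, `[<exists w, N w = k>] by exists (N w0); apply/asboolP; exists w0.
  case/(@ex_maxnP _ #|X|) => [k /asboolP[w <-]|k /asboolP[w1 <-] max].
    exact: max_card.
  by exists w1 => w; apply: max; apply/asboolP; exists w.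
apply: (lt_p w1).
have NE w : (\sum_x (\1_(E x) w)%:E)%E = (N w)%:R%:E :> \bar K.
  rewrite sumEFin -natr_sum /N -sum1dep_card; congr (_%:R%:E).
  by rewrite [RHS]big_mkcond; apply: eq_bigr => x _; case: ifP.
have : (\sum_(x : X) p%:E <= \sum_(x : X) P (E x))%E by apply: lee_sum.
rewrite sumEFin sumr_const -[p *+ _]mulr_natr => /le_trans le_sumP.
rewrite -lee_fin; apply: le_sumP.
have PE x : P (E x) = (\int[P]_w (\1_(E x) w)%:E)%E.
  by rewrite integral_indic // setIT.
under eq_bigr => x _ do rewrite PE.
have mI x := (measurable_EFinP setT _).2 (@measurable_indic _ T K setT _ (mE x)).
rewrite -(ge0_integral_sum _ measurableT) //.
under eq_integral => w _ do rewrite NE.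
apply: (@le_trans _ _ (\int[P]_w (N w1)%:R%:E)%E).
  apply: ge0_le_integral => //.
  - by under eq_fun do rewrite -NE; apply: emeasurable_sum.
  - by move=> w _; rewrite lee_fin ler_nat.
rewrite integral_cst // [X in (_ * X)%E](_ : _ = 1%E) ?mule1 //.
exact: probability_setT.
Qed.

(** * Streaming passes as two-party rounds, and the resulting counting bound *)

Lemma eq_in_foldl (T1 : Type) (T2 : eqType) (f g : T1 -> T2 -> T1) (s : seq T2) (z : T1) :
  (forall z t, t \in s -> f z t = g z t) -> foldl f z s = foldl g z s.
Proof.
elim: s z => //= t s IH z fg; rewrite fg ?mem_head //.
by apply: IH => z' t' st'; apply: fg; rewrite inE st' orbT.
Qed.

(** Alice runs each pass up to time [c], Bob runs the rest, and the memory is the message. Each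
    fills in the other's vector by a fixed one, [y0] or [x0], which does not alter the symbols read
    on their own side of the cut. *)
Lemma run_two_party (Sigma X Y : Type) (n R S : nat) (pi : 'S_n)
    (A : streaming_alg Sigma n R S) (word : X -> Y -> n.-tuple Sigma) (c : nat)
    (x0 : X) (y0 : Y) :
  (forall x y (t : 'I_n), (t < c)%N ->
     tnth (word x y) (pi t) = tnth (word x y0) (pi t)) ->
  (forall x y (t : 'I_n), (c <= t)%N ->
     tnth (word x y) (pi t) = tnth (word x0 y) (pi t)) ->
  exists (alice : 'I_R -> S.-tuple bool -> X -> S.-tuple bool)
         (bob : 'I_R -> S.-tuple bool -> Y -> S.-tuple bool),
    forall x y, run pi A (word x y) =
      sa_output A (foldl (fun q r => bob r (alice r q x) y) (sa_init A) (enum 'I_R)).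
Proof.
move=> wordX wordY.
exists (fun r q x => foldl (fun q t => sa_step A r t q (tnth (word x y0) (pi t)))
                           q (take c (enum 'I_n))).
exists (fun r q y => foldl (fun q t => sa_step A r t q (tnth (word x0 y) (pi t)))
                           q (drop c (enum 'I_n))).
move=> x y; congr (sa_output A _); apply: eq_in_foldl => q r _.
rewrite /run_pass -[in LHS](cat_take_drop c (enum 'I_n)) foldl_cat.
have index_enum (t : 'I_n) : index t (enum 'I_n) = t by rewrite index_enum_ord.
have lt_c (t : 'I_n) : t \in take c (enum 'I_n) -> (t < c)%N.
  by move/index_ltn; rewrite index_enum.
have ge_c (t : 'I_n) : t \in drop c (enum 'I_n) -> (c <= t)%N.
  move=> tc; rewrite leqNgt; apply/negP => tc'.
  have : uniq (take c (enum 'I_n) ++ drop c (enum 'I_n)).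
    by rewrite cat_take_drop enum_uniq.
  rewrite cat_uniq => /and3P[_ /hasPn /(_ t tc) + _].
  by rewrite in_take ?mem_enum // index_enum tc'.
rewrite (eq_in_foldl (g := fun q t => sa_step A r t q (tnth (word x0 y) (pi t)))
    (s := drop _ _)); last by move=> z t /ge_c tc; rewrite wordY.
by congr foldl; apply: eq_in_foldl => z t /lt_c tc; rewrite wordX.
Qed.

(** Being right on two thirds of the inputs means correlation at least [M / 3] with the inner
    product sign, where [M] is [4 ^ m]; the discrepancy bound caps this correlation. *)
Lemma ip_two_party_bound (K : realType) (m : nat) (Q : finType) (pass : Type)
    (alice bob : pass -> Q -> {ffun 'I_m -> bool} -> Q) (out : Q -> nat)
    (rs : seq pass) (q : Q) :
  2%:R / 3%:R * #|{: {ffun 'I_m -> bool} * {ffun 'I_m -> bool}}|%:R <=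
  #|[set ab : {ffun 'I_m -> bool} * {ffun 'I_m -> bool} |
     out (foldl (fun q r => bob r (alice r q ab.1) ab.2) q rs)
       == (1 + m + \sum_(k < m) (ab.1 k && ab.2 k))%N]%SET|%:R :> K ->
  (2 ^ m <= 9 * #|Q| ^ (4 * size rs))%N.
Proof.
set C := [set _ | _]%SET => many.
(* The shift by [1 + m] turns a correct answer into the parity of [|a AND b|], so a correct input
   contributes [1] to the correlation and any other at least [-1]. *)
pose g (q : Q) : K := (-1) ^+ (out q + (1 + m)).
have g1 q' : `|g q'| <= 1 by rewrite normrX normrN1 expr1n.
have := two_party_discrepancy alice bob g1 (@ip_rectangle K m) rs q xpredT xpredT.
rewrite pair_big /=.
set Z := \sum_(ab | _) _; set N := ((#|Q| ^ 2) ^ size rs)%:R : K => Z_le.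
set M : K := #|{: {ffun 'I_m -> bool} * {ffun 'I_m -> bool}}|%:R in many.
have Z_ge : 2 * #|C|%:R - M <= Z.
  have -> : 2 * #|C|%:R - M = \sum_(ab : {ffun 'I_m -> bool} * {ffun 'I_m -> bool})
      (2 * (ab \in C)%:R - 1) :> K.
    rewrite sumrB sumr_const -mulr_sumr -natr_sum; congr (_ * _%:R - _).
    by rewrite -sum1_card big_mkcond; apply: eq_bigr => ab _; case: ifP.
  apply: ler_sum => ab _; case: (boolP (ab \in C)) => [|_].
    rewrite inE => /eqP out_ab.
    rewrite /ip_sign /g out_ab; set s := (\sum_(k < m) _)%N.
    have s2 : (s + (1 + m + s + (1 + m)) = 2 * (1 + m + s))%N by lia.
    rewrite -exprD s2.
    by rewrite exprM sqrrN !expr1n /=; lra.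
  rewrite mulr0 sub0r; set q' := foldl _ q rs.
  have : `|ip_sign K ab.1 ab.2 * g q'| <= 1.
    by rewrite normrM /ip_sign normrX normrN1 expr1n mul1r.
  by rewrite ler_norml => /andP[].
have M4 : M = (2 ^+ m) ^+ 2.
  by rewrite /M card_prod card_ffun card_bool card_ord mulnn !natrX.
have M0 : 0 <= M by rewrite M4 sqr_ge0.
have MZ : M <= 3 * (Num.sqrt (2 ^+ (3 * m)) * N).
  apply: (@le_trans _ _ (3 * Z)); first by lra.
  by rewrite ler_pM2l //; apply: le_trans (ler_norm _) Z_le.
(* Squaring removes the root: [2 ^ (4m)] is at most [9 * 2 ^ (3m) * N ^ 2], and [2 ^ (3m)]
   cancels. *)
have : M ^+ 2 <= (3 * (Num.sqrt (2 ^+ (3 * m)) * N)) ^+ 2.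
  by rewrite lerXn2r ?nnegrE // (le_trans M0 MZ).
rewrite !exprMn sqr_sqrtr ?exprn_ge0 // M4.
have -> : ((2 ^+ m) ^+ 2) ^+ 2 = 2 ^+ (3 * m) * 2 ^+ m :> K.
  by rewrite -!exprM -exprD; congr (_ ^+ _); lia.
rewrite mulrCA ler_pM2l ?exprn_gt0 //.
rewrite /N -!natrX -natrM ler_nat -!expnM.
by rewrite (_ : (2 * (size rs * 2) = 4 * size rs)%N) //; lia.
Qed.

(** * The memory bound for type 1 orders *)

Theorem theorem3 (K : realType) :
  exists c : K, 0 < c /\
    forall (n m R S : nat) (disp : Order.disp_t) (Sigma : orderType disp)
      (pi : 'S_n) (d : measure_display) (T : measurableType d)
      (P : probability T K) (A : T -> streaming_alg Sigma n R S),
      ([set: 'I_n.+1] #<= [set: Sigma])%card ->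
      type1_order pi m ->
      (0 < R)%N ->
      randomized_alg pi A ->
      computes_with_prob pi (@LIS disp Sigma n) (2%:R / 3%:R) P A ->
      c * (m%:R / R%:R) <= S%:R.
Proof.
(* The counting bound will give [m < 4 * S * R + 4]; since [S * R] is positive, [m <= 8 * S * R]
   follows. *)
exists (1 / 8%:R); split; first by rewrite divr_gt0.
move=> n m R S disp Sigma pi d T P A n_Sigma t1 R0 A_rand A_LIS.
case: (posnP m) => [->|m0]; first by rewrite mul0r mulr0.
case: t1 => I [J [i [j [[defI defJ _ _] IJ ij ji j_last]]]].
have [f f_mono] := increasing_enumeration n_Sigma.
pose p k := pi (i k); pose q k := pi (j k).
pose word (a b : {ffun 'I_m -> bool}) : n.-tuple Sigma :=
  [tuple f (hard_key p q a b s) | s < n].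
have two_m : (m.*2 < n.+1)%N.
  have m'm : (m.-1 < m)%N by lia.
  by have := interleave_bounds ij ji j_last (Ordinal m'm); rewrite /=; lia.
have LIS_word a b : LIS (word a b) = (1 + m + \sum_(k < m) (a k && b k))%N.
  have key_lt s t : (tnth (word a b) s < tnth (word a b) t)%O =
                    (hard_key p q a b s < hard_key p q a b t)%N.
    rewrite !tnth_mktuple f_mono // inE; apply: leq_ltn_trans two_m; exact: hard_key_le.
  apply: LIS_eq => [B incB|].
    apply: (increasing_card_le ij ji) => s t sB tB st.
    by rewrite -key_lt; exact: incB.
  have [B incB cardB] := increasing_card_ge a b ij ji j_last m0.
  by exists B => // s t sB tB st; rewrite key_lt; exact: incB.
pose E a b := [set w | run pi (A w) (word a b) = LIS (word a b)].
have mE a b : measurable (E a b).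
  rewrite -[E a b]setTI; exact: (A_rand (word a b) measurableT [set LIS (word a b)]).
(* Without memory the output is a constant of the seed. Yet by averaging over the all-true and the
   all-false pair, one seed is right on more than one of the two, hence on both, although the
   answers [1 + 2m] and [1 + m] differ. *)
have S0 : (0 < S)%N.
  rewrite lt0n; apply/eqP => S0; subst S.
  pose cst (c : bool) : {ffun 'I_m -> bool} := [ffun=> c].
  have [w] := exists_good_seed (fun c => mE (cst c) (cst c))
    (fun c => A_LIS (word (cst c) (cst c))).
  rewrite card_bool => count2.
  have {}count2 : (1 < #|[set c | w \in E (cst c) (cst c)]%SET|)%N.
    by rewrite -(ltr_nat K); apply: lt_le_trans count2; lra.
  have all_c : [set c | w \in E (cst c) (cst c)]%SET = [set: bool]%SET.
    by apply/eqP; rewrite eqEcard finset.subsetT cardsT card_bool.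
  have run_c c : run pi (A w) (word (cst c) (cst c)) = (1 + m + c * m)%N.
    have : c \in [set: bool]%SET by rewrite inE.
    rewrite -all_c inE => /set_mem ->; rewrite LIS_word; congr addn.
    under eq_bigr do rewrite !ffunE andbb.
    by rewrite sum_nat_const card_ord mulnC.
  have : run pi (A w) (word (cst true) (cst true)) =
         run pi (A w) (word (cst false) (cst false)).
    by rewrite /run; congr sa_output; rewrite [LHS]tuple0 [RHS]tuple0.
  by rewrite !run_c; lia.
(* The cut comes just after the last time in [I]; all times in [J] are at or after it. *)
pose c := (\max_(t in I) t.+1)%N.
have I_lt k : (i k < c)%N.
  apply: (leq_bigmax_cond (F := fun t : 'I_n => t.+1) (i k)); rewrite defI.
  by apply/imsetP; exists k.
have J_ge k : (c <= j k)%N.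
  apply/bigmax_leqP => t tI; apply: IJ => //; by rewrite defJ; apply/imsetP; exists k.
pose z : {ffun 'I_m -> bool} := [ffun=> false].
have [w] := exists_good_seed
  (fun ab : {ffun 'I_m -> bool} * {ffun 'I_m -> bool} => mE ab.1 ab.2)
  (fun ab => A_LIS (word ab.1 ab.2)).
have [a b t tc|a b t tc|alice [bob run_AB]] :=
    @run_two_party _ _ _ _ _ _ pi (A w) word c z z.
- rewrite !tnth_mktuple (hard_key_indep_r _ _ b z) // => k.
  by apply/eqP => /perm_inj jk; have := J_ge k; rewrite jk; lia.
- rewrite !tnth_mktuple (hard_key_indep_l _ a z) // => k.
  by apply/eqP => /perm_inj ik; have := I_lt k; rewrite ik; lia.
move=> many.
have := @ip_two_party_bound K m _ _ alice bob (sa_output (A w)) (enum 'I_R)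
  (sa_init (A w)).
rewrite card_tuple card_bool size_enum_ord => bound.
have {}bound : (2 ^ m <= 9 * (2 ^ S) ^ (4 * R))%N.
  apply: bound; apply: le_trans many _; rewrite ler_nat.
  apply/subset_leq_card/fintype.subsetP => ab.
  by rewrite inE => /set_mem Ew; rewrite inE -run_AB Ew LIS_word.
have m_le : (m <= 8 * (S * R))%N.
  (* The additive [4] absorbs the factor [9 < 2 ^ 4]. *)
  have : (m < S * (4 * R) + 4)%N.
    rewrite -(ltn_exp2l _ _ (isT : 1 < 2)%N); apply: leq_ltn_trans bound _.
    by rewrite -expnM expnD mulnC ltn_pmul2l // expn_gt0.
  have : (0 < S * R)%N by rewrite muln_gt0 S0.
  by rewrite mulnCA; lia.
rewrite mulrA ler_pdivrMr ?ltr0n // -natrM mulrAC mul1r ler_pdivrMr ?ltr0n //.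
by rewrite -natrM ler_nat mulnC.
Qed.
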